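(* Let $D$ be a finite directed graph and let $S \subseteq V(D)$ be a set of vertices. Then \[ \max \{|S \cap V(\mathcal{C})| \colon \mathcal{C} \text{ a collection of vertex-disjoint (directed) cycles in } D \} \;\ge\;\min \{|X| \colon X \subseteq V(D) \text{ hits all $S$-cycles in } D\}. \]
   Context: Cycles are directed cycles. An $S$-cycle is a directed cycle of $D$ containing at least one vertex of $S$. $V(\mathcal{C})$ denotes the set of all vertices lying on some cycle of $\mathcal{C}$. A vertex set $X$ hits a cycle if the cycle contains a vertex of $X$. *)

(* Defs.v *)
From mathcomp Require Import all_boot.

Set Implicit Arguments.
Unset Strict Implicit.
Unset Printing Implicit Defensive.

(* A finite digraph is a relation [e : rel T] on a finType,    *)
(* [e x y] meaning that there is an arc from x to y. Parallel arcs are         *)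
(* irrelevant to all notions below; a loop is a cycle of length one.           *)

Section Dicycles.

Variables (T : finType) (e : rel T).
Implicit Types (S X : {set T}) (c : seq T).

(* A directed cycle is given by its vertices in cyclic order from an arbitrary *)
(* starting point. The nonemptiness test is needed because MathComp's [cycle]  *)
(* holds of [::].                                                              *)
Definition dicycle c : bool := [&& c != [::], cycle e c & uniq c].

Lemma dicycle_size c : dicycle c -> size c <= #|T|.
Proof. by case/and3P=> _ _ /card_uniqP <-; apply: max_card. Qed.

(* By [dicycle_size] every directed cycle is an element of this finite type.   *)
Definition vseq := {bseq #|T| of T}.

Definition meets X c : bool := has [in X] c.

(* Distinct rotations of one cycle are not disjoint, so such a collection has  *)
(* at most one representative of each cycle.                                   *)
Definition disjoint_dicycles (C : {set vseq}) : bool :=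
  [forall c in C, dicycle c] &&
  [forall c in C, forall d in C, (c != d) ==> [disjoint c & d]].

Definition vertices (C : {set vseq}) : {set T} :=
  \bigcup_(c in C) [set x in c].

Definition hits_all S X : bool :=
  [forall c : vseq, dicycle c && meets S c ==> meets X c].

Lemma hits_allP S X :
  reflect (forall c, dicycle c -> meets S c -> meets X c) (hits_all S X).
Proof.
apply: (iffP forallP) => [hX c cc Sc | hX c].
  by have /implyP := hX (Bseq (dicycle_size cc)); apply; apply/andP.
by apply/implyP => /andP[]; apply: hX.
Qed.

Lemma hits_allT S : hits_all S [set: T].
Proof.
by apply/hits_allP => c _ /hasP[x xc _]; apply/hasP; exists x; rewrite ?inE.
Qed.

Lemma disjoint_dicycles0 : disjoint_dicycles set0.
Proof. by apply/andP; split; apply/forallP => c; rewrite inE. Qed.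

(* The maximum of a family that contains 0, by [disjoint_dicycles0].           *)
Definition max_covered S : nat :=
  \max_(C : {set vseq} | disjoint_dicycles C) #|S :&: vertices C|.

(* The default [set: T] is itself a candidate, by [hits_allT].                 *)
Definition min_hitting S : nat :=
  #|[arg min_(X < [set: T] | hits_all S X) #|X| ]|.

End Dicycles.

(* Main.v *)
Require Import Defs.
From mathcomp Require Import fingroup perm all_boot all_order all_algebra zify.

(** Collections of disjoint dicycles correspond to permutations whose non-fixed
    points all move along an arc (a fixed point counts as covered when it carries
    a loop), so [max_covered] is the optimum of an assignment problem. For an
    optimal permutation, the exchange digraph has no positive cycle and therefore
    has an integral potential, which yields an integral optimal dual solution
    [(u, v)]. Each [u x + v x] is nonnegative and they sum to the optimum, so the
    set [X] of vertices with [u x + v x > 0] is small enough. Summing the dual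
    constraints [u x + v y >= (x \in S)] along a dicycle that avoids [X] shows
    that it avoids [S]. *)

Import Order.TTheory GRing.Theory Num.Theory.

Section Potential.

Local Open Scope ring_scope.

Variables (T : finType) (r : rel T) (k : T -> T -> int).

Let walk_cost x p : int := \sum_(a <- pairmap k x p) a.

Lemma sum_next_pairmap x p : uniq (x :: p) ->
  \sum_(y <- x :: p) k y (next (x :: p) y) = walk_cost x (rcons p x).
Proof.
move=> Up; rewrite /walk_cost [LHS](big_nth x) [RHS](big_nth 0) size_pairmap size_rcons.
rewrite [LHS]big_nat [RHS]big_nat; apply: eq_bigr => i /andP[_ ltip].
rewrite (nth_pairmap x) ?size_rcons // next_nth mem_nth // index_uniq //.
rewrite -rcons_cons !nth_rcons ltip if_same.
(* At the last vertex, [i = size p], the default [x] of [nth] is the vertex that closes the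
   cycle. *)
by case: (ltnP i (size p)) => // /(nth_default x) ->.
Qed.

(** Take for [u x] the largest cost of a simple [r]-path from [x]: an arc followed by an optimal
    path from [y] competes for [u x], unless it revisits [x]. *)
Lemma exists_potential :
    (forall x p, cycle r (x :: p) -> uniq (x :: p) ->
       \sum_(y <- x :: p) k y (next (x :: p) y) <= 0) ->
  exists u : T -> int, forall x y, r x y -> k x y + u y <= u x.
Proof.
move=> cyc0.
pose ok x (p : vseq T) := path r x p && uniq (x :: p).
have best x : exists2 p : vseq T, ok x p &
    forall q : vseq T, ok x q -> walk_cost x q <= walk_cost x p.
  have ok0 : ok x [bseq] by [].
  by case: (arg_maxP (fun p : vseq T => walk_cost x p) ok0) => p okp maxp; exists p.
have [opt ok_opt opt_max] := fin_all_exists2 best.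
exists (fun x => walk_cost x (opt x)) => x y rxy.
have opt_x (q : seq T) : path r x q -> uniq (x :: q) ->
    walk_cost x q <= walk_cost x (opt x).
  move=> pq Uq; have sq : (size q <= #|T|)%N.
    by apply: ltnW; rewrite -[X in (X <= _)%N]/(size (x :: q)) -(card_uniqP Uq) max_card.
  by apply: (opt_max x (Bseq sq)); apply/andP.
have ok_y := ok_opt y.
case/andP: ok_y => py Uy.
have -> : k x y + walk_cost y (opt y) = walk_cost x (y :: opt y).
  by rewrite /walk_cost big_cons.
have pxy : path r x (y :: opt y) by rewrite /= rxy.
(* If the optimal walk from [y] returns to [x], cutting off the simple cycle
   through [x] does not decrease the cost. *)
have [xin | xnin] := boolP (x \in y :: opt y); last first.
  by apply: opt_x => //; rewrite cons_uniq xnin.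
move: pxy Uy; case/splitPr: xin => p1 p2.
rewrite cat_path cat_uniq /= => /and3P[pp1 rp1 pp2] /and4P[Up1 /norP[xp1 _] xp2 Up2].
rewrite /walk_cost -cat_rcons pairmap_cat last_rcons big_cat /=.
have le0 : walk_cost x (rcons p1 x) <= 0.
  by rewrite -sum_next_pairmap /= ?xp1 //; apply: cyc0; rewrite /= ?rcons_path ?pp1 ?xp1.
by rewrite -[leRHS]add0r lerD // opt_x //= xp2.
Qed.

End Potential.

Section NextPerm.

Local Open Scope ring_scope.

Variables (T : finType) (c : seq T) (Uc : uniq c).

Definition next_perm : {perm T} := perm (can_inj (prev_next Uc)).

Lemma next_permE x : next_perm x = next c x.
Proof. exact: permE. Qed.

Lemma next_notin x : x \notin c -> next c x = x.
Proof. by move=> xc; rewrite next_nth (negPf xc). Qed.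

Lemma sum_next (F : T -> int) : \sum_(x <- c) F (next c x) = \sum_(x <- c) F x.
Proof.
rewrite !big_uniq // [RHS](reindex_inj (@perm_inj _ next_perm)) /=.
by apply: eq_big => x; rewrite next_permE ?mem_next.
Qed.

End NextPerm.

Section Duality.

Local Open Scope ring_scope.

Variables (T : finType) (e : rel T) (S : {set T}).

Definition dicycle_perm (s : {perm T}) := [forall x, (s x == x) || e x (s x)].

Definition arc_weight x y : int := ((x \in S) && e x y)%:R.

Definition perm_weight (s : {perm T}) : int := \sum_x arc_weight x (s x).

(** The orbits of [s] inside [M] are disjoint dicycles covering [M], and [s] has weight
    [#|S :&: M|]. *)
Lemma perm_weight_max_covered s :
  dicycle_perm s -> perm_weight s <= (max_covered e S)%:R.
Proof.
move=> /forallP es.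
pose M := [set x | e x (s x)].
have orbM x y : x \in M -> y \in orbit s x -> y \in M.
  move=> xM; rewrite -fconnect_orbit => /iter_findex <-.
  elim: (findex _ _ _) => //= n; rewrite !inE => IH.
  (* If [s] fixes this point, injectivity identifies it with its preimage, which is in [M] by
     induction. *)
  have /orP[/eqP sK|//] := es (s (iter n s x)).
  by rewrite (perm_inj sK).
have s_inj : injective s := @perm_inj _ s.
have cycM x : x \in M -> dicycle e (orbit s x).
  move=> xM; rewrite /dicycle orbit_uniq -size_eq0 size_orbit -lt0n order_gt0 andbT /=.
  apply: (sub_in_cycle (P := mem (orbit s x))) (cycle_orbit s_inj x); last exact/allP.
  by move=> y z /(orbM _ _ xM); rewrite inE => esy _ /eqP <-.
have size_orb x : (size (orbit s x) <= #|T|)%N by rewrite size_orbit max_card.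
pose orb x : vseq T := Bseq (size_orb x).
(* Starting orbits at canonical roots keeps a single rotation of each cycle. *)
pose C := [set orb x | x in [set froot s y | y in M]].
have root_orb y : y \in orbit s (froot s y).
  by rewrite -fconnect_orbit fconnect_sym // connect_root.
have rootM y : y \in M -> froot s y \in M.
  by move=> yM; apply: (orbM y) => //; rewrite -fconnect_orbit connect_root.
have dC : disjoint_dicycles e C.
  apply/andP; split; apply/forallP => c; apply/implyP => /imsetP[_ /imsetP[y yM ->] ->].
    exact/cycM/rootM.
  apply/forallP => d; apply/implyP => /imsetP[_ /imsetP[z zM ->] ->].
  rewrite disjoint_has; apply/implyP; apply: contraNN => /hasP[t ty tz].
  move: ty tz; rewrite -!fconnect_orbit => ty tz.
  suff -> : froot s y = froot s z by [].
  have csym := fconnect_sym s_inj.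
  rewrite -(root_root csym y) -(root_root csym z).
  by rewrite (fingraph.rootP csym ty) (fingraph.rootP csym tz).
have MC : M \subset vertices C.
  apply/subsetP => y yM; apply/bigcupP; exists (orb (froot s y)).
    by rewrite !imset_f.
  by rewrite inE root_orb.
have -> : perm_weight s = #|S :&: M|%:R.
  rewrite /perm_weight -sum1_card natr_sum [RHS]big_mkcond; apply: eq_bigr => x _.
  by rewrite /arc_weight !inE; case: ifP.
rewrite ler_nat; apply: leq_trans (leq_bigmax_cond _ dC).
by rewrite subset_leq_card // setIS.
Qed.

Lemma exists_dual : exists s : {perm T}, exists u v : T -> int,
  [/\ dicycle_perm s,
      forall x y, (x == y) || e x y -> arc_weight x y <= u x + v y &
      \sum_x (u x + v x) = perm_weight s].
Proof.
have ok1 : dicycle_perm 1%g by apply/forallP => x; rewrite perm1 eqxx.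
case: (arg_maxP perm_weight ok1) => s ok_s max_s.
pose a x y := (x == s y) || e x (s y).
pose k x y := arc_weight x (s y) - arc_weight y (s y).
(* [k x y] is the gain of [x] when [x] takes over the image of [y]. *)
have [x p cp Up|u u_ge] := @exists_potential T a k.
  set c := x :: p in cp Up *.
  (* Along an exchange cycle, [t] gives each vertex the image of its successor; the total gain is
     the change of weight from [s] to [t], so maximality of [s] bounds it by 0. *)
  pose t := (next_perm _ _ Up * s)%g.
  have tE y : t y = s (next c y) by rewrite permM next_permE.
  have ok_t : dicycle_perm t.
    apply/forallP => y; rewrite tE; have [yc|ync] := boolP (y \in c).
      by have := next_cycle cp yc; rewrite /a eq_sym.
    by rewrite next_notin // (forallP ok_s).
  have -> : \sum_(y <- c) k y (next c y) = perm_weight t - perm_weight s.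
    rewrite /perm_weight [X in _ - X](reindex_inj (@perm_inj _ (next_perm _ _ Up))) /=.
    rewrite -sumrB big_uniq // [LHS]big_mkcond; apply: eq_bigr => y _.
    by rewrite tE next_permE; case: ifPn => // /next_notin ->; rewrite subrr.
  by rewrite subr_le0; apply: max_s.
(* This [v] makes the constraint tight on every pair [(x, s x)], whence the sum. *)
exists s, u, (fun y => arc_weight ((s^-1)%g y) y - u ((s^-1)%g y)).
split=> // [x y exy|].
  have := u_ge x ((s^-1)%g y); rewrite /a /k permKV => /(_ exy); lia.
rewrite big_split /= addrC sumrB (reindex_inj (@perm_inj _ s)) /=.
rewrite [X in _ - X + _](reindex_inj (@perm_inj _ s)) /=.
rewrite /perm_weight.
under eq_bigr do rewrite permK.
under [X in _ - X + _]eq_bigr do rewrite permK.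
by rewrite subrK.
Qed.

Lemma dual_hits_all (u v : T -> int) :
    (forall x y, (x == y) || e x y -> arc_weight x y <= u x + v y) ->
  hits_all e S [set x | 0 < u x + v x].
Proof.
move=> dual; apply/hits_allP => c /and3P[_ cc Uc] /hasP[x xc xS].
apply/negPn/negP => /hasPn noX.
have: \sum_(y <- c) (u y + v y) <= 0.
  rewrite -oppr_ge0 -sumrN big_seq sumr_ge0 // => y /noX.
  by rewrite inE -leNgt oppr_ge0.
(* Shifting [v] one step along [c] pairs [u y] with [v (next c y)], as in the constraint of an
   arc. *)
apply/negP; rewrite -ltNge big_split /= -(sum_next _ _ Uc v) -big_split /=.
apply: (@lt_le_trans _ _ (\sum_(y <- c) arc_weight y (next c y))); last first.
  rewrite big_seq [leRHS]big_seq ler_sum // => y yc.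
  by rewrite dual // (next_cycle cc yc) orbT.
rewrite (big_rem x) //= /arc_weight xS (next_cycle cc xc) /=.
by rewrite ltr_pwDl // sumr_ge0 // => y _; rewrite ler0n.
Qed.

End Duality.

Theorem theorem2p7 (T : finType) (e : rel T) (S : {set T}) :
  max_covered e S >= min_hitting e S.
Proof.
have [s [u [v [ok_s dual sum_dual]]]] := exists_dual T e S.
have hX := dual_hits_all T e S u v dual.
rewrite -(ler_nat int); apply: le_trans (perm_weight_max_covered T e S s ok_s).
rewrite -sum_dual /min_hitting; case: arg_minnP => [|Y _ minY]; first exact: hits_allT.
have := minY _ hX; rewrite -(ler_nat int) => /le_trans; apply.
(* By integrality a positive [u x + v x] is at least 1; elsewhere the constraint at [(x, x)] makes
   it nonnegative. *)
rewrite -sum1_card natr_sum big_mkcond /=; apply: ler_sum => x _.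
rewrite inE; case: ifP => // _.
by apply: le_trans (dual x x _); rewrite ?eqxx ?ler0n.
Qed.
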